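(* Let $G$ and $H$ be graphs, where $H$ has no isolated vertices. Then $$\gamma_{gr}^{t}(G\circ H)=\max\{\,a(D)\,(\gamma_{gr}^{t}(H)-1)+|\widehat{D}|\ :\ D\text{ is a dominating sequence of }G\,\}.$$
   Context: Graphs are finite, simple and undirected, with nonempty vertex set. $N(v)$ and $N[v]=N(v)\cup\{v\}$ denote open and closed neighborhoods. A sequence $(v_1,\ldots,v_k)$ of distinct vertices of a graph is a (legal) open neighborhood sequence if $N(v_i)\setminus\bigcup_{j=1}^{i-1}N(v_j)\neq\emptyset$ for each $i$; the Grundy total domination number $\gamma_{gr}^{t}$ of a graph is the maximum length of such a sequence. A dominating sequence of $G$ is a legal closed neighborhood sequence, i.e. a sequence $D=(d_1,\ldots,d_k)$ of distinct vertices of $G$ with $N[d_i]\setminus\bigcup_{j=1}^{i-1}N[d_j]\neq\emptyset$ for each $i$. $\widehat{D}=\{d_1,\ldots,d_k\}$ is the underlying set of $D$, and $a(D)$ is the number of vertices $d_i$ of $D$ that are not adjacent to any vertex from $\{d_1,\ldots,d_{i-1}\}$. The lexicographic product $G\circ H$ has vertex set $V(G)\times V(H)$, and $(g_1,h_1)$, $(g_2,h_2)$ are adjacent iff $g_1g_2\in E(G)$, or $g_1=g_2$ and $h_1h_2\in E(H)$. *)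

(* Defs.v *)
From mathcomp Require Import all_boot.

Set Implicit Arguments.
Unset Strict Implicit.
Unset Printing Implicit Defensive.

Record graph := Graph {
  vertex :> finType;
  adj : rel vertex;
  adj_sym : symmetric adj;
  adj_irrefl : irreflexive adj;
  vertex_nonempty : 0 < #|vertex|
}.

Definition open_nbhd (G : graph) (v : G) : {set G} := [set u | adj v u].

Definition closed_nbhd (G : graph) (v : G) : {set G} := v |: open_nbhd v.

Definition no_isolated (G : graph) : Prop := forall v : G, open_nbhd v != set0.

(* Positions are numbered from 0. *)
Definition legal_seq (T : finType) (N : T -> {set T}) (s : seq T) : bool :=
  uniq s &&
  [forall i : 'I_(size s),
     N (tnth (in_tuple s) i)
       :\: \bigcup_(j < size s | j < i) N (tnth (in_tuple s) j) != set0].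

Definition open_nbhd_seq (G : graph) (s : seq G) : bool :=
  legal_seq (@open_nbhd G) s.

Definition dominating_seq (G : graph) (s : seq G) : bool :=
  legal_seq (@closed_nbhd G) s.

(* Legal sequences have no repetition, so all of them occur among the
   sequences of length at most #|G|, which form a finite type. *)
Definition grundy_total (G : graph) : nat :=
  \max_(s : #|G|.-bseq G | open_nbhd_seq s) size s.

(* Counted by position, which for a repetition-free D is the number of
   vertices of D not adjacent to any earlier one. *)
Definition a_num (G : graph) (D : seq G) : nat :=
  #|[set i : 'I_(size D) |
      [forall j : 'I_(size D),
         (j < i) ==> ~~ adj (tnth (in_tuple D) i) (tnth (in_tuple D) j)]]|.

Section LexProduct.

Variables G H : graph.

Definition lex_adj (x y : G * H) : bool :=
  adj x.1 y.1 || ((x.1 == y.1) && adj x.2 y.2).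

Lemma lex_adj_sym : symmetric lex_adj.
Proof. by move=> x y; rewrite /lex_adj adj_sym eq_sym (adj_sym x.2). Qed.

Lemma lex_adj_irrefl : irreflexive lex_adj.
Proof. by move=> x; rewrite /lex_adj !adj_irrefl andbF. Qed.

Lemma lex_nonempty : 0 < #|{: G * H}|.
Proof. by rewrite card_prod muln_gt0 !vertex_nonempty. Qed.

Definition lex_product : graph :=
  Graph lex_adj_sym lex_adj_irrefl lex_nonempty.

End LexProduct.

(* Hence grundy_total H - 1 is not truncated when H has no isolated vertex. *)
Lemma grundy_total_gt0 (H : graph) : no_isolated H -> 0 < grundy_total H.
Proof.
move=> Hiso; have /card_gt0P[v _] := vertex_nonempty H.
have sz : size [:: v] <= #|H| by exact: vertex_nonempty.
apply: (leq_trans _ (leq_bigmax_cond (Bseq sz) _)) => //=.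
rewrite /open_nbhd_seq /legal_seq /=; apply/forallP => i.
rewrite big_pred0 ?setD0 ?Hiso // => j.
by rewrite !ord1.
Qed.

(* Main.v *)
Require Import Defs.
From mathcomp Require Import all_boot.
From mathcomp Require Import zify.

Set Implicit Arguments.
Unset Strict Implicit.
Unset Printing Implicit Defensive.

(** Write k for the Grundy total domination number of H.

    Lower bound: read a dominating sequence D of G from left to right, replacing
    a vertex d not adjacent to earlier ones by (d, t_1), ..., (d, t_k), where
    (t_i) is a maximum open neighborhood sequence of H, and any other vertex d
    by a single (d, h).

    Upper bound: scan an open neighborhood sequence S of the product from left
    to right.  A vertex (g, h) whose layer g was already visited can only
    footprint inside its own layer, hence extends an open neighborhood sequence
    of H attached to g.  If layer g is new, g is appended to D, unless (g, h) only
    footprints layers that were already visited.  Such a layer u has no visited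
    neighbor and is not yet totally dominated, so the sequence attached to u can
    be extended instead; this happens once per u because (g, h) dominates the
    whole layer u. *)

(** * Legal sequences for an arbitrary neighborhood map *)

Section LegalSequences.

Variables (T : finType) (N : T -> {set T}).
Implicit Types (s p q : seq T) (x y u : T).

(** Splitting [s] at [x] replaces the indices of the definition; distinctness follows because a
    repeated vertex has no new footprint. *)
Lemma legal_seqP s :
  reflect (forall p x q, s = p ++ x :: q ->
             exists2 u, u \in N x & forall y, y \in p -> u \notin N y)
          (legal_seq N s).
Proof.
apply: (iffP andP) => [[_ /forallP leg] p x q def_s | leg].
  have lt_p : size p < size s by rewrite def_s size_cat /= -addSnnS leq_addr.
  have nth_p j : j < size p -> nth x s j = nth x p j.
    by move=> ltjp; rewrite def_s nth_cat ltjp.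
  have := leg (Ordinal lt_p); rewrite (tnth_nth x) /=.
  have -> : nth x s (size p) = x by rewrite def_s nth_cat ltnn subnn.
  case/set0Pn => u /setDP[uNx /bigcupP uNs]; exists u => // y y_p.
  apply/negP => uNy; apply: uNs.
  have lt_y : index y p < size p by rewrite index_mem.
  exists (Ordinal (ltn_trans lt_y lt_p)) => //.
  by rewrite (tnth_nth x) /= nth_p // nth_index.
split.
  elim/last_ind: s leg => // s x IHs leg; rewrite rcons_uniq IHs ?andbT.
    have [|u uNx uNs] := leg s x [::]; first by rewrite cats1.
    by apply: contraL uNx => /uNs.
  by move=> p y q def_s; apply: (leg p y (rcons q x)); rewrite def_s rcons_cat.
apply/forallP => i; set x := tnth _ i.
have nth_i j : tnth (in_tuple s) j = nth x s j by apply: tnth_nth.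
have [|u uNx uNs] := leg (take i s) x (drop i.+1 s).
  by rewrite {1}/x (nth_i i) -drop_nth // cat_take_drop.
apply/set0Pn; exists u; rewrite inE uNx andbT; apply/bigcupP => -[j ltji].
apply/negP/uNs; rewrite nth_i -(nth_take x ltji) mem_nth //.
by rewrite size_take ltn_ord.
Qed.

Lemma legal_seq_nil : legal_seq N [::].
Proof. by apply/legal_seqP => -[]. Qed.

Lemma legal_seq_rcons s x :
  legal_seq N (rcons s x) <->
  legal_seq N s /\ exists2 u, u \in N x & forall y, y \in s -> u \notin N y.
Proof.
split=> [/legal_seqP leg | [/legal_seqP leg leg_x]].
  split; last by apply: (leg s x [::]); rewrite cats1.
  apply/legal_seqP => p y q def_s.
  by apply: (leg p y (rcons q x)); rewrite def_s rcons_cat.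
apply/legal_seqP => p y q; case/lastP: q => [|q z].
  by rewrite cats1 => /rcons_inj[<- <-].
by rewrite -rcons_cons -rcons_cat => /rcons_inj[/leg].
Qed.

Lemma legal_seq_uniq s : legal_seq N s -> uniq s.
Proof. by case/andP. Qed.

Lemma legal_seq_size s : legal_seq N s -> size s <= #|T|.
Proof. by move/legal_seq_uniq/card_uniqP <-; apply: max_card. Qed.

End LegalSequences.

(** * The Grundy total domination number and the count a(D) *)

Section Graphs.

Variable G : graph.
Implicit Types (D s : seq G) (v : G).

Lemma open_nbhd_seq_grundy s : open_nbhd_seq s -> size s <= grundy_total G.
Proof.
move=> leg_s.
exact: (@leq_bigmax_cond _ _ (fun t : #|G|.-bseq G => size t)
         (Bseq (legal_seq_size leg_s))).
Qed.

Lemma grundy_total_attained :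
  exists2 s : seq G, open_nbhd_seq s & size s = grundy_total G.
Proof.
have [|s leg_s def_k] := @eq_bigmax_cond _ (@open_nbhd_seq G : pred (_.-bseq G))
  (fun t : #|G|.-bseq G => size t); last by exists s.
by apply/card_gt0P; exists (Bseq (leq0n _ : size [::] <= _)); apply: legal_seq_nil.
Qed.

(** A range of naturals survives appending a vertex, whereas the ordinals below [size D] change
    type; [v] is the default of [nth]. *)
Lemma a_num_nth v D :
  a_num D = \sum_(0 <= i < size D | all (fun y => ~~ adj (nth v D i) y) (take i D)) 1.
Proof.
rewrite big_mkord /a_num -sum1_card; apply: eq_bigl => i; rewrite inE.
apply/forallP/(all_nthP v) => /= [nadj j | nadj j].
  rewrite size_take ltn_ord => ltji; rewrite nth_take //.
  by have /implyP/(_ ltji) := nadj (Ordinal (ltn_trans ltji (ltn_ord i)));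
    rewrite !(tnth_nth v).
apply/implyP => ltji; rewrite !(tnth_nth v) /= -(nth_take v ltji).
by apply: nadj; rewrite size_take ltn_ord.
Qed.

Lemma a_num_rcons D v : a_num (rcons D v) = a_num D + all (fun y => ~~ adj v y) D.
Proof.
rewrite !(a_num_nth v) size_rcons [LHS]big_mkcond big_nat_recr //=.
rewrite nth_rcons ltnn eqxx -cats1 takel_cat // take_size cats1.
congr (_ + _).
rewrite [RHS]big_mkcond; apply: eq_big_nat => i /= ltiD.
by rewrite nth_rcons ltiD -cats1 takel_cat // ltnW.
Qed.

Lemma a_num_nil : @a_num G [::] = 0.
Proof. by apply: eq_card0 => -[]. Qed.

End Graphs.

(** * The two bounds for the lexicographic product *)

Section Lexicographic.

Variables G H : graph.
Hypothesis hH : no_isolated H.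

Let GH := lex_product G H.
Let k := grundy_total H.

Lemma no_isolated_nbr (h : H) : exists h', adj h h'.
Proof. by have /set0Pn[h'] := hH h; rewrite inE; exists h'. Qed.

Lemma mem_lex_nbhd (x u : GH) :
  (u \in open_nbhd x) = adj x.1 u.1 || ((x.1 == u.1) && adj x.2 u.2).
Proof. by rewrite inE. Qed.

(** [S] does not reach layer [d], so a footprint [x] of [h] in [t] yields the footprint [(d, x)] of
    [(d, h)]. *)
Lemma legal_cat_layer (S : seq GH) (d : G) (t : seq H) :
  open_nbhd_seq S -> open_nbhd_seq t ->
  (forall y, y \in S -> ~~ adj d y.1 /\ d != y.1) ->
  open_nbhd_seq (S ++ [seq ((d, h) : GH) | h <- t]).
Proof.
move=> leg_S + far_d; elim/last_ind: t => [|t h IHt]; first by rewrite cats0.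
case/legal_seq_rcons => /IHt leg_St [x xNh xNt].
rewrite map_rcons -rcons_cat; apply/legal_seq_rcons; split=> //.
exists (d, x) => [|y].
  by move: xNh; rewrite mem_lex_nbhd inE /= eqxx => ->; rewrite orbT.
rewrite mem_cat mem_lex_nbhd => /orP[/far_d[nadj neq]|/mapP[h' /xNt]] /=.
  by rewrite adj_sym (negPf nadj) eq_sym (negPf neq).
by rewrite inE => nadj -> /=; rewrite adj_irrefl eqxx.
Qed.

Lemma lex_lower_bound (D : seq G) :
  dominating_seq D ->
  exists S : seq GH, [/\ open_nbhd_seq S,
    forall y, y \in S -> y.1 \in D & size S = a_num D * (k - 1) + size D].
Proof.
have [t leg_t size_t] := grundy_total_attained H.
have /card_gt0P[h _] := vertex_nonempty H.
elim/last_ind: D => [|D d IHD leg_Dd].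
  by exists [::]; rewrite a_num_nil; split=> //; apply: legal_seq_nil.
have := legal_seq_uniq leg_Dd; rewrite rcons_uniq => /andP[dD _].
case/legal_seq_rcons: leg_Dd => /IHD[S [leg_S S_D size_S]] [u uNd uND].
rewrite a_num_rcons size_rcons; have [/allP nadj | adj_d] := boolP (all _ D).
  exists (S ++ [seq ((d, h) : GH) | h <- t]); split.
  - apply: legal_cat_layer => // y /S_D y_D; split; first exact: nadj.
    by apply: contraNneq dD => ->.
  - by move=> y; rewrite mem_rcons inE mem_cat => /orP[/S_D-> | /mapP[? _ ->]];
      rewrite ?orbT ?eqxx.
  - have := grundy_total_gt0 hH.
    by rewrite size_cat size_map size_S size_t -/k mulnDl mul1n; lia.
exists (rcons S (d, h)); split; last by rewrite size_rcons size_S addn0 addnS.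
(* An earlier neighbor already dominates [d], so [u] is not [d] but adjacent to it, and [(d, h)]
   footprints the whole layer [u]. *)
- apply/legal_seq_rcons; split=> //; exists (u, h).
    rewrite mem_lex_nbhd /=; move: uNd; rewrite !inE => /predU1P[u_d | -> //].
    case/allPn: adj_d => y /uND; rewrite u_d !inE negb_or adj_sym => /andP[_].
    by move->.
  move=> y /S_D/uND; rewrite mem_lex_nbhd !inE negb_or eq_sym => /andP[/negPf-> /negPf->] //.
- by move=> y; rewrite !mem_rcons !inE => /predU1P[-> | /S_D->]; rewrite ?eqxx ?orbT.
Qed.

(* [T g] is the open neighborhood sequence of H attached to [g]; [A] collects
   the vertices that had no visited neighbor when they were first visited. *)
Lemma lex_upper_bound_invariant (S : seq GH) :
  open_nbhd_seq S ->
  exists (D : seq G) (A : {set G}) (T : G -> seq H),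
  [/\ dominating_seq D,
      {subset D <= [seq y.1 | y <- S]} /\ {subset A <= [seq y.1 | y <- S]},
      #|A| <= a_num D /\ size S + #|A| = \sum_(g in A) size (T g) + size D,
      forall g, g \in A -> open_nbhd_seq (T g)
    & forall g, g \in [seq y.1 | y <- S] ->
        (forall y, y \in S -> ~~ adj y.1 g) ->
        g \in A /\ forall x h, h \in T g -> adj h x ->
          exists2 y, y \in S & ((g, x) : GH) \in open_nbhd y].
Proof.
(* The first vertex seen in a layer of [A] counts both in [D] and in its attached sequence, whence
   [#|A|] on the left. The last clause skips layers with a visited neighbor: they are totally
   dominated and can no longer be footprinted. *)
elim/last_ind: S => [_|S [g h] IHS].
  exists [::], set0, (fun=> [::]); rewrite cards0 a_num_nil big_set0.
  split=> //; first exact: legal_seq_nil.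
  - by split=> // x; rewrite inE.
  - by move=> x; rewrite inE.
case/legal_seq_rcons => /IHS{IHS}[D [A [T [leg_D [D_S A_S] [le_A size_S] leg_T cov_T]]]].
case=> -[u x] uNgh uNS.
have nadj_u y : y \in S -> ~~ adj y.1 u.
  by move/uNS; rewrite mem_lex_nbhd negb_or => /andP[].
rewrite !map_rcons size_rcons /=.
have grow (B : {pred G}) : {subset B <= [seq y.1 | y <- S]} ->
    {subset B <= rcons [seq y.1 | y <- S] g}.
  by move=> B_S z /B_S; rewrite mem_rcons inE orbC => ->.
have grow_nadj z : (forall y, y \in rcons S (g, h) -> ~~ adj y.1 z) ->
    ~~ adj g z /\ forall y, y \in S -> ~~ adj y.1 z.
  move=> nadj; split; first by apply: (nadj (g, h)); rewrite mem_rcons mem_head.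
  by move=> y yS; apply: nadj; rewrite mem_rcons inE yS orbT.
have grow_cov z w : (exists2 y, y \in S & ((z, w) : GH) \in open_nbhd y) ->
    exists2 y, y \in rcons S (g, h) & ((z, w) : GH) \in open_nbhd y.
  by case=> y yS yN; exists y => //; rewrite mem_rcons inE yS orbT.
have [u_S | u_S] := boolP (u \in [seq y.1 | y <- S]).
  (* The footprint lies in a visited layer, whose attached sequence grows. *)
  have [uA covTu] := cov_T _ u_S nadj_u.
  (* If [g] is adjacent to [u], any neighbor of [x] may extend [T u], since the last clause then
     lapses for [u]; otherwise it must be [h]. *)
  have [h' [adj_h'x def_h']] : exists h', adj h' x /\ (~~ adj g u -> u = g /\ h' = h).
    move: uNgh; rewrite mem_lex_nbhd /= => /orP[-> | /andP[/eqP-> adj_hx]].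
      by have [h'] := no_isolated_nbr x; exists h'; rewrite adj_sym.
    by exists h.
  exists D, A, (fun z => if z == u then rcons (T u) h' else T z); split=> //.
  - by split; apply: grow.
  - split=> //; rewrite addSn size_S (bigD1 u) //= [in RHS](bigD1 u) //= eqxx size_rcons.
    rewrite !addSn; congr (_ + _ + _).+1; apply: eq_bigr => z /andP[_ /negPf-> //].
  - move=> z zA; case: eqP => [_ | _]; last exact: leg_T.
    apply/legal_seq_rcons; split; first exact: leg_T.
    exists x; first by rewrite inE.
    (* Otherwise [S] would already dominate [(u, x)]. *)
    move=> y yT; rewrite inE; apply/negP => /(covTu _ _ yT)[w /uNS].
    by move=> + wN; rewrite wN.
  move=> z z_Sg /grow_nadj[nadj_gz nadj_Sz].
  (* If [g] is new, it has the visited neighbor [u], so nothing is asked of it. *)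
  have zS : z \in [seq y.1 | y <- S].
    move: z_Sg; rewrite mem_rcons inE => /predU1P[z_g | //].
    move: uNgh; rewrite mem_lex_nbhd z_g /= => /orP[adj_gu | /andP[/eqP-> //]].
    case/mapP: u_S => y yS u_y; have := nadj_Sz y yS.
    by rewrite z_g -u_y adj_sym adj_gu.
  have [zA cov_z] := cov_T _ zS nadj_Sz; split=> // w h1; case: eqP => [z_u | _].
    subst z; rewrite mem_rcons inE => /predU1P[-> | h1T] adj_w.
      have [u_g h'_h] := def_h' nadj_gz.
      exists (g, h); first by rewrite mem_rcons mem_head.
      by rewrite mem_lex_nbhd /= u_g eqxx -h'_h adj_w orbT.
    by apply: grow_cov; apply: cov_z adj_w.
  by move=> h1T adj_w; apply: grow_cov; apply: cov_z adj_w.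
(* Otherwise [g] was not visited and [u] is undominated in the closed sense. *)
have gS : g \notin [seq y.1 | y <- S].
  apply/negP => gS; move: uNgh; rewrite mem_lex_nbhd /= => /orP[adj_gu | /andP[/eqP g_u _]].
    by case/mapP: gS => y /nadj_u + g_y; rewrite -g_y adj_gu.
  by rewrite -g_u gS in u_S.
have gA : g \notin A by apply: contra gS => /A_S.
have leg_Dg : dominating_seq (rcons D g).
  apply/legal_seq_rcons; split=> //; exists u.
    move: uNgh; rewrite mem_lex_nbhd !inE /= eq_sym => /orP[-> | /andP[-> //]].
    by rewrite orbT.
  move=> y /D_S yS; rewrite !inE negb_or; apply/andP; split.
    by apply: contraNneq u_S => ->.
  by case/mapP: yS => w /nadj_u + ->.
have Dg_Sg : {subset rcons D g <= rcons [seq y.1 | y <- S] g}.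
  by move=> z; rewrite !mem_rcons !inE => /predU1P[-> | /D_S->]; rewrite ?eqxx ?orbT.
have [nadj_g | /allPn[y0 y0S /negPn adj_g]] := boolP (all (fun y => ~~ adj g y.1) S).
  exists (rcons D g), (g |: A), (fun z => if z == g then [:: h] else T z); split=> //.
  - split=> // z; rewrite mem_rcons !inE => /predU1P[-> | /A_S->]; rewrite ?eqxx ?orbT //.
  - rewrite cardsU1 gA a_num_rcons size_rcons big_setU1 //= eqxx.
    have -> : all (fun y => ~~ adj g y) D.
      by apply/allP => z /D_S/mapP[y /(allP nadj_g) + ->].
    split; first by rewrite addnC leq_add2r.
    have -> : \sum_(z in A) size (if z == g then [:: h] else T z)
              = \sum_(z in A) size (T z).
      by apply: eq_bigr => z zA; case: eqP => // z_g; rewrite z_g (negPf gA) in zA.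
    by rewrite addSn addnCA size_S /= addnS addnA.
  - move=> z; rewrite !inE; case: eqP => [_ _ | _ /leg_T //].
    apply/(@legal_seq_rcons _ _ [::]); split; first exact: legal_seq_nil.
    by have [h'] := no_isolated_nbr h; exists h'; rewrite ?inE.
  move=> z z_Sg /grow_nadj[nadj_gz nadj_Sz]; rewrite !inE.
  case: eqP z_Sg => [-> _ | neq_zg]; last first.
    rewrite mem_rcons inE => /predU1P[// | zS].
    have [zA cov_z] := cov_T _ zS nadj_Sz; split=> // w h1 h1T adj_w.
    by apply: grow_cov; apply: cov_z adj_w.
  split=> // w h1; rewrite inE => /eqP-> adj_w.
  exists (g, h); first by rewrite mem_rcons mem_head.
  by rewrite mem_lex_nbhd /= eqxx adj_w orbT.
(* The visited neighbor of [g] need not be in [D], so [a_num] may grow while [A] does not; hence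
   only an inequality. *)
exists (rcons D g), A, T; split=> //.
- by split=> //; apply: grow.
- split; first by rewrite a_num_rcons (leq_trans le_A) ?leq_addr.
  by rewrite size_rcons addSn addnS size_S.
move=> z z_Sg /grow_nadj[nadj_gz nadj_Sz].
have zS : z \in [seq y.1 | y <- S].
  move: z_Sg; rewrite mem_rcons inE => /predU1P[z_g | //].
  by have := nadj_Sz _ y0S; rewrite z_g adj_sym adj_g.
have [zA cov_z] := cov_T _ zS nadj_Sz; split=> // w h1 h1T adj_w.
by apply: grow_cov; apply: cov_z adj_w.
Qed.

(** Each attached sequence has length at most [k], and the term [#|A|] cancels one unit of each,
    leaving the factor [k - 1]. *)
Lemma lex_upper_bound (S : seq GH) :
  open_nbhd_seq S ->
  exists2 D : seq G, dominating_seq D & size S <= a_num D * (k - 1) + size D.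
Proof.
case/lex_upper_bound_invariant => D [A [T [leg_D _ [le_A size_S] leg_T _]]].
exists D => //; rewrite -(leq_add2r #|A|) size_S.
have le_T : \sum_(g in A) size (T g) <= #|A| * k.
  by rewrite -sum_nat_const leq_sum // => g /leg_T; apply: open_nbhd_seq_grundy.
have k_gt0 : 0 < k := grundy_total_gt0 hH.
have le_Ak : #|A| * (k - 1) <= a_num D * (k - 1) by rewrite leq_mul2r le_A orbT.
have def_Ak : #|A| * k = #|A| * (k - 1) + #|A| by rewrite -mulnSr subn1 prednK.
lia.
Qed.

End Lexicographic.

Theorem theorem3p1 (G H : graph) (hH : no_isolated H) :
  grundy_total (lex_product G H) =
  \max_(D : #|G|.-bseq G | dominating_seq D)
     (a_num D * (grundy_total H - 1) + #|[set x in D]|).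
Proof.
have card_D (D : seq G) : dominating_seq D -> #|[set x in D]| = size D.
  by move=> /legal_seq_uniq/card_uniqP <-; apply: eq_card => x; rewrite inE.
apply/eqP; rewrite eqn_leq; apply/andP; split; apply/bigmax_leqP.
  move=> S /(lex_upper_bound hH)[D leg_D /leq_trans-> //].
  rewrite -card_D //.
  exact: (@leq_bigmax_cond _ _
    (fun D : #|G|.-bseq G => a_num D * (grundy_total H - 1) + #|[set x in D]|)
    (Bseq (legal_seq_size leg_D))).
move=> D leg_D; rewrite card_D //.
by have [S [leg_S _ <-]] := lex_lower_bound hH leg_D; apply: open_nbhd_seq_grundy.
Qed.
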